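(* Every ACLT group is supersolvable.
   Context: All groups are finite. A finite group $G$ is an ACLT (Abelian CLT) group if for every proper divisor $d$ of $|G|$ (positive divisor $d\neq |G|$), $G$ contains an abelian subgroup of order $d$. *)

(* Defs.v *)
From mathcomp Require Import all_boot all_fingroup all_solvable.

Set Implicit Arguments.
Unset Strict Implicit.
Unset Printing Implicit Defensive.

Local Open Scope group_scope.

(* Positivity of [d] is automatic, since [d] divides [#|G| > 0]. *)
Definition ACLT (gT : finGroupType) (G : {group gT}) : Prop :=
  forall d : nat, d %| #|G| -> d != #|G| ->
  exists A : {group gT}, [/\ A \subset G, abelian A & #|A| = d].

(* Every term must be normal in the whole group [G], not just in the next
   term: the latter would only define polycyclic (for finite groups,
   solvable) groups. *)
Definition cyclic_normal_factor (gT : finGroupType) (G H K : {set gT}) : bool :=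
  [&& H <| G, K <| G, H \subset K & cyclic (K / H)].

Definition supersolvable (gT : finGroupType) (G : {group gT}) : Prop :=
  exists2 s : seq {group gT},
    (cyclic_normal_factor G).-series 1%G s & last 1%G s = G.

(* Main.v *)
Require Import Defs.
From mathcomp Require Import all_boot all_fingroup all_solvable.

(** If [G] is a [p]-group it is nilpotent, and its upper central series
    refines to a [G]-invariant series with cyclic factors, since every subgroup
    of a central factor is [G]-invariant ([central_factor_series]).

    Otherwise let [p < q] be prime divisors of [#|G|], and let [A] and [B] be
    abelian subgroups of index [p] and [q]. The indices are coprime, so
    [G = A * B]; hence [A :&: B], which is centralised by both [A] and [B], is
    central, and the quotient of [G] by it has order [p * q]. As in every group
    of order [p * q], the subgroup of order [q], the image of [A], is normal
    ([normal_small_index_over]). So [1 <= A :&: B <= A <= G] consists of a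
    central subgroup followed by two factors of prime order, and refines to
    the required series. *)

Set Implicit Arguments.
Unset Strict Implicit.
Unset Printing Implicit Defensive.

Local Open Scope group_scope.

(** Relativises [supersolvable], which is the case [H = G], so that series can
    be built upwards one normal subgroup at a time. *)
Definition cyclic_series_upto (gT : finGroupType) (G H : {group gT}) : Prop :=
  exists2 s : seq {group gT},
    (cyclic_normal_factor G).-series 1%G s & last 1%G s = H.

Lemma cyclic_series_upto1 (gT : finGroupType) (G : {group gT}) :
  cyclic_series_upto G 1.
Proof. by exists [::]. Qed.

Lemma cyclic_series_step (gT : finGroupType) (G H K : {group gT}) :
  cyclic_series_upto G H -> cyclic_normal_factor G H K ->
  cyclic_series_upto G K.
Proof.
case=> s series_s last_s factorHK; exists (rcons s K); last exact: last_rcons.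
by rewrite rcons_path series_s last_s.
Qed.

Lemma prime_index_series_step (gT : finGroupType) (G H K : {group gT}) :
    cyclic_series_upto G H -> H <| G -> K <| G -> H \subset K ->
    prime #|K : H| ->
  cyclic_series_upto G K.
Proof.
move=> seriesH nsHG nsKG sHK prHK; apply: cyclic_series_step seriesH _.
have nHK: K \subset 'N(H) := subset_trans (normal_sub nsKG) (normal_norm nsHG).
by rewrite /cyclic_normal_factor nsHG nsKG sHK prime_cyclic ?card_quotient.
Qed.

(** Adjoining to [K] one element of [H] at a time gives a cyclic factor, and the
    enlarged group is still normal in [G] because its commutators with [G] all
    lie in [K]. *)
Lemma central_factor_series (gT : finGroupType) (G H K : {group gT}) :
    K \subset H -> H \subset G -> [~: H, G] \subset K ->
  cyclic_series_upto G K -> cyclic_series_upto G H.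
Proof.
move=> + sHG cHG; move: {2}_.+1 (ltnSn (#|H| - #|K|)) => n.
elim: n K cHG => // n IHn K cHG ltHKn sKH seriesK.
have [sHK | /subsetPn[x Hx K'x]] := boolP (H \subset K).
  by rewrite (_ : H = K) //; apply/group_inj/eqP; rewrite eqEsubset sHK.
have normal_between (L : {group gT}) : K \subset L -> L \subset H -> L <| G.
  move=> sKL sLH; rewrite /normal (subset_trans sLH sHG) -commg_subl.
  by rewrite (subset_trans (commSg G sLH)) // (subset_trans cHG).
have nsKG := normal_between K (subxx _) sKH.
have nKx: <[x]> \subset 'N(K).
  by rewrite cycle_subG (subsetP (normal_norm nsKG)) ?(subsetP sHG).
pose L := (K <*> <[x]>)%G.
have sKL: K \subset L := joing_subl _ _.
have sLH: L \subset H by rewrite join_subG sKH cycle_subG.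
have ltKL: #|K| < #|L|.
  apply/proper_card/properP; split=> //; exists x => //.
  by rewrite -cycle_subG joing_subr.
apply: (IHn L) => //.
- exact: subset_trans cHG sKL.
- apply: leq_trans (ltn_sub2l _ ltKL) ltHKn.
  exact: leq_trans ltKL (subset_leq_card sLH).
apply: cyclic_series_step seriesK _.
rewrite /cyclic_normal_factor nsKG normal_between // sKL /=.
by rewrite quotientYidl // quotient_cyclic // cycle_cyclic.
Qed.

Lemma nilpotent_supersolvable (gT : finGroupType) (G : {group gT}) :
  nilpotent G -> supersolvable G.
Proof.
case/ucnP=> n defG.
have seriesZ m : cyclic_series_upto G 'Z_m(G).
  elim: m => [|m IHm].
    rewrite (_ : 'Z_0(G)%G = 1%G); first exact: cyclic_series_upto1.
    by apply/group_inj; rewrite /= ucn0.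
  by apply: central_factor_series (ucn_comm m G) IHm;
    rewrite ?ucn_sub ?ucn_subS.
by have := seriesZ n; rewrite (_ : 'Z_n(G)%G = G) //; apply: group_inj.
Qed.

(** For a conjugate [A :^ x] different from [A], the index of [A :^ x :&: A] in
    [A] divides the prime [#|A : Z|] because [Z] lies in both groups, and is not
    1. So it equals [#|A : Z|], and [A :^ x * A] has [#|A| * #|A : Z|] elements,
    more than the [#|A| * #|G : A|] elements of [G]. *)
Lemma normal_small_index_over (gT : finGroupType) (G A Z : {group gT}) :
    Z <| G -> Z \subset A -> A \subset G ->
    prime #|A : Z| -> #|G : A| < #|A : Z| ->
  A <| G.
Proof.
move=> nsZG sZA sAG prAZ ltGA; rewrite /normal sAG.
apply/subsetP=> x Gx; apply: contraLR ltGA => nAx; rewrite -leqNgt.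
have sZAx: Z \subset A :^ x.
  by rewrite -(normP (subsetP (normal_norm nsZG) x Gx)) conjSg.
have ntAx: #|A : A :^ x| != 1%N.
  apply: contra nAx; rewrite indexg_eq1 => sAAx; apply/normP/esym/eqP.
  by rewrite eqEcard sAAx cardJg /=.
have /(prime_nt_dvdP prAZ ntAx) <-: #|A : A :^ x| %| #|A : Z| by exact: indexgS.
rewrite -(leq_pmul2l (cardG_gt0 A)) Lagrange // -{1}(cardJg A x) LagrangeMl.
by rewrite subset_leq_card // mul_subG // conj_subG.
Qed.

Lemma mul_abelian_centralI (gT : finGroupType) (A B : {group gT}) :
  abelian A -> abelian B -> A * B \subset 'C(A :&: B).
Proof.
move=> abA abB; rewrite mul_subG //.
  by rewrite (subset_trans abA) // centS ?subsetIl.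
by rewrite (subset_trans abB) // centS ?subsetIr.
Qed.

Lemma ACLT_prime_index (gT : finGroupType) (G : {group gT}) p :
    ACLT G -> prime p -> p %| #|G| ->
  exists A : {group gT}, [/\ A \subset G, abelian A & #|G : A| = p].
Proof.
move=> hG pr_p dvd_p.
have [||A [sAG abA oA]] := hG (#|G| %/ p)%N.
- exact: dvdn_div.
- by rewrite neq_ltn ltn_Pdiv ?prime_gt1.
by exists A; split=> //; rewrite -divgS // oA divnA // mulKn.
Qed.

Theorem theorem4p10 (gT : finGroupType) (G : {group gT}) (hG : ACLT G) :
  supersolvable G.
Proof.
(* The least prime divisor of the order, so that any other one is larger; for
   trivial [G] it is 1, and the primary case below holds vacuously. *)
pose p := pdiv #|G|.
have [pG | /allPn[q]] := boolP (all (mem (p : nat_pred)) (primes #|G|)).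
  apply/nilpotent_supersolvable/(@pgroup_nil _ p).
  by rewrite /pgroup /pnat cardG_gt0.
rewrite mem_primes cardG_gt0 /= inE => /andP[pr_q dvd_q] q'p.
have lt_pq: p < q by rewrite ltn_neqAle eq_sym q'p pdiv_min_dvd ?prime_gt1.
have dvd_p: p %| #|G| := pdiv_dvd _.
have pr_p: prime p.
  apply: pdiv_prime; exact: leq_trans (prime_gt1 pr_q) (dvdn_leq _ dvd_q).
have [A [sAG abA iA]] := ACLT_prime_index hG pr_p dvd_p.
have [B [sBG abB iB]] := ACLT_prime_index hG pr_q dvd_q.
have co_pq: coprime p q.
  by rewrite prime_coprime // dvdn_prime2 // neq_ltn lt_pq.
have defG: A * B = G by apply: coprime_index_mulG; rewrite ?iA ?iB.
have iAZ: #|A : A :&: B| = q.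
  apply/eqP; rewrite indexgI -(eqn_pmul2l (cardG_gt0 B)) LagrangeMl -iB.
  by rewrite Lagrange // (@coprime_index_mulG _ G) // iA iB coprime_sym.
have cZG: A :&: B \subset 'C(G).
  by rewrite centsC -defG mul_abelian_centralI.
have sZG: A :&: B \subset G := subset_trans (subsetIl _ _) sAG.
have nsZG: A :&: B <| G by apply: sub_center_normal; rewrite subsetI sZG.
have seriesZ: cyclic_series_upto G (A :&: B).
  apply: central_factor_series (cyclic_series_upto1 G) => //.
    exact: sub1G.
  by rewrite subG1; apply/eqP/commG1P.
have nsAG: A <| G.
  apply: normal_small_index_over nsZG (subsetIl _ _) sAG _ _;
    by rewrite /= iAZ ?iA.
have seriesA: cyclic_series_upto G A.
  apply: prime_index_series_step seriesZ nsZG nsAG (subsetIl _ _) _.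
  by rewrite iAZ.
apply: prime_index_series_step seriesA nsAG (normal_refl G) sAG _.
by rewrite iA.
Qed.
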